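(* Let $\Delta\ge3$ and $0\le C\le\Delta-3$. For every $n$ there exists a graph $G$ with maximum degree $\Delta$ that is properly $(\Delta+C)$-edge colored except for one uncolored edge $e$, such that the coloring can be extended to $e$ while recoloring only $O(1)$ edges, but any shift-based algorithm has recourse at least $$\max_{q\in[1,\Delta-C-2]\cap\mathbb N} R\big(\lfloor n/(q+1)\rfloor,\ \Delta-q,\ C\big).$$ In particular, for $C=0$ the shift-based recourse is $\Omega(n/\Delta)$, and for $\Delta\ge4$ and $C\ge1$ it is $\Omega\!\left(\log\frac{nC}{(\Delta-C)^2}\big/\log\frac{\Delta+C}{\Delta-C}\right)$.
   Context: $R(n,\Delta,C)$ denotes the worst-case minimum recourse needed to complete the coloring of an input graph $H$ with $n$ vertices and maximum degree $\Delta$ that is properly $(\Delta+C)$-edge colored except for one edge: i.e., the maximum, over all such $H$ and partial colorings, of the minimum number of already-colored edges whose colors must change in any proper $(\Delta+C)$-edge coloring of all of $H$ extending it. A sequence of edges $[e_1,\dots,e_k]$ is a chain if consecutive edges share exactly one endpoint; it is shiftable if for every prefix, giving each $e_i$ the current color of $e_{i+1}$ and leaving the last edge of the prefix uncolored yields a proper partial coloring; it is useful if $e_1$ is uncolored and after shifting the last edge $e_k$ can be given a color unused by its adjacent edges. A shift-based algorithm extends a coloring to an uncolored edge only by shifting along a useful shiftable chain starting there and coloring its last edge; its recourse is the number of previously colored edges whose color changes. *)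

(* Defs.v *)
From mathcomp Require Import all_boot.

Set Implicit Arguments.
Unset Strict Implicit.
Unset Printing Implicit Defensive.

Section EdgeColoring.

(* A simple graph on V is given by its set of edges E, the edges being
   two-element sets of vertices. A coloring is a function on all of {set V},
   None meaning uncolored; its values outside E are never looked at. *)
Variable V : finType.
Implicit Types (E : {set {set V}}) (e f g : {set V}) (p : seq {set V}).

Definition simple_graph E : bool := [forall f in E, #|f| == 2].

Definition degree E (v : V) : nat := #|[set f in E | v \in f]|.

Definition max_degree E : nat := \max_(v : V) degree E v.

Definition adjacent f g : bool := (f != g) && (f :&: g != set0).

Variable k : nat.
Implicit Types c : {ffun {set V} -> option 'I_k}.

Definition proper_coloring E c : bool :=
  [forall f in E, forall g in E,
    adjacent f g ==> (c f != None) ==> (c f != c g)].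

Definition full_coloring E c : bool :=
  proper_coloring E c && [forall f in E, c f != None].

Definition colored_except E c e : bool :=
  [&& e \in E, proper_coloring E c & [forall f in E, (c f == None) == (f == e)]].

(* Number of edges already colored by c whose color is different in c'. *)
Definition recourse E c c' : nat :=
  #|[set f in E | (c f != None) && (c' f != c f)]|.

(* The default value #|E| bounds every recourse, so it has no effect as soon as
   E has a full coloring. *)
Definition min_recourse E c : nat :=
  \big[minn/#|E|]_(c' | full_coloring E c') recourse E c c'.

Definition chain E e p : bool :=
  all (mem E) (e :: p) && path (fun f g => #|f :&: g| == 1) e p.

Definition recolor c e (a : option 'I_k) : {ffun {set V} -> option 'I_k} :=
  [ffun f => if f == e then a else c f].

(* The shift is done one edge at a time, so that it also makes sense for chains
   that visit an edge several times. *)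
Fixpoint shift c e p : {ffun {set V} -> option 'I_k} :=
  if p is f :: p' then shift (recolor (recolor c e (c f)) f None) f p' else c.

Definition shiftable E c e p : Prop :=
  forall j : nat, proper_coloring E (shift c e (take j p)).

Definition unused E c e (a : 'I_k) : bool :=
  [forall f in E, adjacent e f ==> (c f != Some a)].

Definition useful E c e p : Prop :=
  c e = None /\ exists a, unused E (shift c e p) (last e p) a.

(* c' is a possible output of a shift-based algorithm run on the coloring c and
   the uncolored edge e. *)
Definition shift_based E c e c' : Prop :=
  exists p, [/\ chain E e p, shiftable E c e p, useful E c e p &
    exists2 a, unused E (shift c e p) (last e p) a &
               c' = recolor (shift c e p) (last e p) (Some a)].

End EdgeColoring.

(* R(n, D, C). The maximum ranges over the graphs that do have a proper
   (D + C)-edge coloring (a restriction only if C = 0); it is 0 if there is no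
   such graph with n vertices and maximum degree D. *)
Definition worst_recourse (n D C : nat) : nat :=
  \max_(E : {set {set 'I_n}} | [&& simple_graph E, max_degree E == D &
          [exists c : {ffun {set 'I_n} -> option 'I_(D + C)}, full_coloring E c]])
    \max_(c : {ffun {set 'I_n} -> option 'I_(D + C)}
            | [exists e, colored_except E c e])
      min_recourse E c.

(* Main.v *)
Require Import Defs.
From mathcomp Require Import all_boot all_order all_algebra.
From mathcomp Require Import reals exp.
From mathcomp Require Import boolp zify ring lra.

Import Order.TTheory GRing.Theory Num.Theory.
Local Open Scope ring_scope.

(** Take a worst-case instance H for R(n/(q+1), Delta - q, C) and attach to every
    vertex q pendant edges carrying q fresh colors. A shift can never give the
    uncolored edge a fresh color, since its other endpoint sees that color too; hence a
    shift-based algorithm recolors H itself. Without shifts, one gives the edge a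
    fresh color and recolors the two pendant edges in conflict.

    For the lower bound on R(N, D, C), put h = (D - C)/2 and g = h + C, and join
    consecutive layers, whose sizes grow by a factor g/h, so that every vertex has
    at most h edges upwards and g edges downwards. The cuts alternate between two
    color types with g colors each; two such graphs, with types exchanged, are
    joined by the uncolored edge at their tops. Whatever its color, that edge has
    the type of the g edges below one of its ends, so one of these must change
    its type, and so on down to the last layer. The number of layers is about
    log(NC/h^2)/log(g/h). One takes q = Delta - 2 and layers of size 1 (a path)
    if C = 0, and q in {1, 2} of the parity of Delta - C otherwise. *)

(** * Proper colorings and the minimum recourse *)

Section Colorings.
Local Open Scope nat_scope.
Variables (V : finType) (k : nat).
Implicit Types (E : {set {set V}}) (c : {ffun {set V} -> option 'I_k}).

Lemma proper_coloringP E c :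
  reflect (forall f f', f \in E -> f' \in E -> adjacent f f' -> c f != None ->
             c f != c f')
          (proper_coloring E c).
Proof.
apply: (iffP forall_inP) => [H f f' fE f'E adj cf|H f fE].
  have /forall_inP/(_ _ f'E) := H f fE.
  by rewrite adj cf.
by apply/forall_inP => f' f'E; apply/implyP => adj; apply/implyP; apply: H.
Qed.

Lemma full_coloringP E c :
  reflect ((forall f f', f \in E -> f' \in E -> adjacent f f' -> c f != c f') /\
           (forall f, f \in E -> c f != None))
          (full_coloring E c).
Proof.
apply: (iffP andP) => [[/proper_coloringP H /forall_inP H']|[H H']].
  by split=> // f f' fE f'E adj; apply: H => //; apply: H'.
split; last exact/forall_inP.
by apply/proper_coloringP => f f' fE f'E adj _; apply: H.
Qed.

Lemma min_recourse_le E c c' :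
  full_coloring E c' -> min_recourse E c <= recourse E c c'.
Proof.
move=> Hc'; rewrite /min_recourse.
have : c' \in index_enum {ffun {set V} -> option 'I_k} by rewrite mem_index_enum.
elim: (index_enum _) => // a s IH.
rewrite inE big_cons => /orP[/eqP <-|/IH H]; first by rewrite Hc' geq_minl.
by case: ifP => // _; rewrite geq_min H orbT.
Qed.

Lemma le_min_recourse E c r : (exists c', full_coloring E c') ->
  (forall c', full_coloring E c' -> r <= recourse E c c') ->
  r <= min_recourse E c.
Proof.
move=> [c0 c0P] H; rewrite /min_recourse.
(* The default value [#|E|] of the minimum is covered by [c0], whose recourse counts edges of
   [E]. *)
elim/big_rec: _ => [|c' x /H Hc' Hx]; last by rewrite leq_min Hc'.
apply: leq_trans (H _ c0P) _.
by apply: subset_leq_card; apply/subsetP => f; rewrite inE => /andP[].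
Qed.

End Colorings.

(** The number of colors is a variable tied by an equation, so that layered graphs, colored with
    [g + g] colors, fit without a cast. *)
Lemma worst_recourse_ge (N D C k r : nat) (E : {set {set 'I_N}})
    (c cf : {ffun {set 'I_N} -> option 'I_k}) (e : {set 'I_N}) :
  k = (D + C)%N -> simple_graph E -> max_degree E = D -> full_coloring E cf ->
  colored_except E c e ->
  (forall c', full_coloring E c' -> (r <= recourse E c c')%N) ->
  (r <= worst_recourse N D C)%N.
Proof.
move=> kE sE dE fE ce Hr; subst k.
apply: (@bigop.bigmax_sup _ E).
  by rewrite sE dE eqxx; apply/existsP; exists cf.
apply: (@bigop.bigmax_sup _ c); first by apply/existsP; exists e.
by apply: le_min_recourse => //; exists cf.
Qed.

(** * Graphs with [q] pendant edges at every vertex *)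

Section PendantEdges.
Local Open Scope nat_scope.
Variables (V W : finType) (k q : nat) (cod : V * option 'I_q -> W).
Hypothesis codI : injective cod.
Variable E : {set {set V}}.
Hypothesis simpleE : simple_graph E.

(** The graph is carried into [W] by an injection because the number of vertices of the final graph
    is prescribed; points outside the image of [cod] are isolated. *)
Definition core (v : V) : W := cod (v, None).
Definition leaf (v : V) (r : 'I_q) : W := cod (v, Some r).
Definition core_edge (f : {set V}) : {set W} := core @: f.
Definition pendant (v : V) (r : 'I_q) : {set W} := [set core v; leaf v r].
Definition pendant_graph : {set {set W}} :=
  [set core_edge f | f in E] :|: [set pendant vr.1 vr.2 | vr : V * 'I_q].

Lemma coreI : injective core.
Proof. by move=> v v' /codI []. Qed.

Lemma leafI v v' r r' : leaf v r = leaf v' r' -> v = v' /\ r = r'.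
Proof. by move=> /codI [-> ->]. Qed.

Lemma core_leaf v v' r : (core v == leaf v' r) = false.
Proof. by apply/eqP => /codI. Qed.

Lemma mem_core_edge v f : (core v \in core_edge f) = (v \in f).
Proof. by rewrite mem_imset //; apply: coreI. Qed.

Lemma leaf_core_edge v r f : (leaf v r \in core_edge f) = false.
Proof.
by apply/imsetP => -[x _ /eqP]; rewrite eq_sym core_leaf.
Qed.

Lemma core_edgeI : injective core_edge.
Proof. exact/imset_inj/coreI. Qed.

Lemma pendantI v v' r r' : pendant v r = pendant v' r' -> v = v' /\ r = r'.
Proof.
move=> /setP /(_ (leaf v r)); rewrite !inE eqxx orbT.
rewrite eq_sym core_leaf => /=; case: eqP => [/leafI [-> ->]|] //.
Qed.

Lemma core_edge_pendant f v r : (core_edge f == pendant v r) = false.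
Proof.
by apply/eqP => /setP/(_ (leaf v r)); rewrite leaf_core_edge !inE eqxx orbT.
Qed.

Lemma mem_core_pendant v v' r : (core v \in pendant v' r) = (v == v').
Proof. by rewrite !inE core_leaf orbF (inj_eq coreI). Qed.

Variant pendant_graph_spec : {set W} -> Prop :=
| CoreEdge f of f \in E : pendant_graph_spec (core_edge f)
| PendantEdge v r : pendant_graph_spec (pendant v r).

Lemma pendant_graphP F : F \in pendant_graph -> pendant_graph_spec F.
Proof. by case/setUP => /imsetP[? ? ->]; constructor. Qed.

Lemma core_edge_in f : f \in E -> core_edge f \in pendant_graph.
Proof. by move=> fE; rewrite inE imset_f. Qed.

Lemma pendant_in v r : pendant v r \in pendant_graph.
Proof. by rewrite inE (imset_f _ (_ : (v, r) \in _)) ?orbT. Qed.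

Lemma core_edge_meet f f' :
  (core_edge f :&: core_edge f' != set0) = (f :&: f' != set0).
Proof. by rewrite -imsetI ?imset_eq0 // => x y _ _; apply: coreI. Qed.

Lemma core_pendant_meet f v r :
  (core_edge f :&: pendant v r != set0) = (v \in f).
Proof.
apply/set0Pn/idP => [[x]|vf].
  rewrite !inE => /andP[xf /orP[]/eqP xE]; move: xf; rewrite xE.
    by rewrite mem_core_edge.
  by rewrite leaf_core_edge.
by exists (core v); rewrite inE mem_core_edge vf mem_core_pendant /=.
Qed.

Lemma pendant_meet v v' r r' : pendant v r :&: pendant v' r' != set0 -> v = v'.
Proof.
case/set0Pn => x; rewrite !inE.
case/andP => /orP[]/eqP-> /orP[] => [/eqP/coreI//||/eqP/esym/eqP|/eqP/leafI[]//];
  by rewrite core_leaf.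
Qed.

Lemma edge_card f : f \in E -> #|f| = 2.
Proof. by move=> fE; apply/eqP; apply: (forall_inP simpleE). Qed.

Lemma pendant_graph_simple : simple_graph pendant_graph.
Proof.
apply/forall_inP => F /pendant_graphP[f fE|v r].
  by rewrite card_imset ?edge_card //; apply: coreI.
by rewrite cards2 core_leaf.
Qed.

Lemma degree_core v : degree pendant_graph (core v) = degree E v + q.
Proof.
rewrite /degree.
have -> : [set F in pendant_graph | core v \in F] =
    core_edge @: [set f in E | v \in f] :|: pendant v @: setT.
  apply/setP => F; rewrite inE; apply/andP/setUP.
    case; case/pendant_graphP => [f fE|v' r].
      by rewrite mem_core_edge => vf; left; rewrite imset_f ?inE ?fE.
    by rewrite mem_core_pendant => /eqP <-; right; rewrite imset_f.
  case=> /imsetP[f fP ->]; last by rewrite pendant_in mem_core_pendant.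
  by move: fP; rewrite inE => /andP[fE vf]; rewrite core_edge_in // mem_core_edge.
rewrite cardsU (_ : _ :&: _ = set0) ?cards0 ?subn0.
  by rewrite (card_imset _ core_edgeI) card_imset ?cardsT ?card_ord // => r r' /pendantI[].
apply/setP => F; rewrite !inE; apply/andP => -[/imsetP[f _ ->] /imsetP[r _]].
by move/eqP; rewrite core_edge_pendant.
Qed.

Lemma degree_noncore w : w \notin codom core -> degree pendant_graph w <= 1.
Proof.
move=> wC; have [/codomP[[v [r|]] wE]|wL] := boolP (w \in codom cod).
- rewrite -(cards1 (pendant v r)); apply: subset_leq_card.
  apply/subsetP => F; rewrite in_set wE => /andP[].
  case/pendant_graphP => [f fE|v' r']; first by rewrite leaf_core_edge.
  by rewrite !inE eq_sym core_leaf => /eqP/leafI[-> ->].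
- by rewrite wE codom_f in wC.
rewrite /degree (_ : [set _ in _ | _] = set0) ?cards0 //.
apply/setP => F; rewrite in_set [RHS]inE; apply: contraNF wL.
case/andP; case/pendant_graphP => [f fE /imsetP[v _ ->]|v r]; first exact: codom_f.
by rewrite !inE => /orP[] /eqP->; apply: codom_f.
Qed.

Lemma pendant_graph_max_degree :
  0 < max_degree E + q -> 0 < #|V| ->
  max_degree pendant_graph = max_degree E + q.
Proof.
move=> pos V0; apply/eqP; rewrite eqn_leq; apply/andP; split.
  apply/bigmax_leqP => w _.
  have [/codomP[v ->]|/degree_noncore H] := boolP (w \in codom core).
    by rewrite degree_core leq_add2r leq_bigmax.
  exact: leq_trans H pos.
rewrite /max_degree; have [v ->] := bigop.eq_bigmax (degree E) V0.
by rewrite -degree_core leq_bigmax.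
Qed.

(** This serves for the partial coloring, for its cheap extension and for the full coloring of a
    star. *)
Definition glue_coloring {m} (a : {set V} -> option 'I_m) (b : V -> 'I_q -> 'I_m) :
    {ffun {set W} -> option 'I_m} :=
  [ffun F => if [pick vr : V * 'I_q | F == pendant vr.1 vr.2] is Some vr
             then Some (b vr.1 vr.2) else a (core @^-1: F)].

Lemma glue_core {m} a b f : @glue_coloring m a b (core_edge f) = a f.
Proof.
rewrite ffunE; case: pickP => [vr|_]; first by rewrite core_edge_pendant.
congr a; apply/setP => v.
by rewrite inE mem_core_edge.
Qed.

Lemma glue_pendant {m} a b v r : @glue_coloring m a b (pendant v r) = Some (b v r).
Proof.
rewrite ffunE; case: pickP => [vr /eqP/pendantI[<- <-] //|/(_ (v, r))].
by rewrite eqxx.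
Qed.

Lemma glue_proper {m} (a : {ffun {set V} -> option 'I_m}) b :
  proper_coloring E a -> (forall v, injective (b v)) ->
  (forall f v r, f \in E -> v \in f -> a f != Some (b v r)) ->
  proper_coloring pendant_graph (glue_coloring a b).
Proof.
move=> /proper_coloringP aP bI ab; apply/proper_coloringP => F F'.
case/pendant_graphP => [f fE|v r] /pendant_graphP[f' f'E|v' r'] /andP[nFF' meet].
- rewrite !glue_core; apply: aP => //; rewrite /adjacent -core_edge_meet meet.
  by rewrite andbT; apply: contraNneq nFF' => ->.
- by move=> _; rewrite glue_core glue_pendant ab // -(core_pendant_meet f v' r').
- by move=> _; rewrite glue_core glue_pendant eq_sym ab // -(core_pendant_meet f' v r) setIC.
have vv' := pendant_meet _ _ _ _ meet; subst v'.
rewrite !glue_pendant => _.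
by apply: contraNneq nFF' => -[] /bI ->.
Qed.

Variables (c : {ffun {set V} -> option 'I_k}) (e : {set V}).
Hypothesis cP : colored_except E c e.

Definition pendant_coloring : {ffun {set W} -> option 'I_(k + q)} :=
  glue_coloring (fun f => omap (@lshift k q) (c f)) (fun _ r => rshift k r).

Lemma pendant_coloring_core f :
  pendant_coloring (core_edge f) = omap (@lshift k q) (c f).
Proof. exact: glue_core. Qed.

Lemma pendant_coloring_pendant v r :
  pendant_coloring (pendant v r) = Some (rshift k r).
Proof. exact: glue_pendant. Qed.

Let eE : e \in E.  Proof. by case/and3P: cP. Qed.

Let c_none f : f \in E -> (c f == None) = (f == e).
Proof. by case/and3P: cP => _ _ /forall_inP H /H/eqP. Qed.

Let c_e : c e = None.
Proof. by apply/eqP; rewrite c_none ?eqxx ?eE. Qed.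

Lemma omap_lshift_eq (x y : option 'I_k) :
  (omap (@lshift k q) x == omap (@lshift k q) y) = (x == y).
Proof. exact/inj_eq/inj_omap/lshift_inj. Qed.

Lemma pendant_coloring_colored_except :
  colored_except pendant_graph pendant_coloring (core_edge e).
Proof.
case/and3P: (cP) => _ /proper_coloringP cprop _; apply/and3P; split.
- exact/core_edge_in/eE.
- have -> : pendant_coloring =
      glue_coloring [ffun f => omap (@lshift k q) (c f)] (fun _ r => rshift k r).
    by apply/ffunP => F; rewrite !ffunE; case: pickP => // _; rewrite ffunE.
  apply: glue_proper => [|v r r' /rshift_inj //|f v r fE vf]; last first.
    by rewrite ffunE; case: (c f) => //= i; rewrite (inj_eq Some_inj) eq_lrshift.
  apply/proper_coloringP => f f' fE f'E adj; rewrite !ffunE omap_lshift_eq.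
  by have := cprop _ _ fE f'E adj; case: (c f) => // i H _; apply: H.
apply/forall_inP => F /pendant_graphP[f fE|v r]; apply/eqP.
  rewrite pendant_coloring_core (inj_eq core_edgeI) -c_none //.
  by case: (c f).
by rewrite pendant_coloring_pendant [RHS]eq_sym core_edge_pendant.
Qed.

(** The edge [e] takes the fresh color [r0]. At each end [v] of [e], the pendant edge of that color
    moves to an old color missing at [v]: there is one, since [v] has at most [k] edges and [e] is
    uncolored. *)
Lemma pendant_extend : max_degree E <= k -> 0 < q ->
  exists2 c', full_coloring pendant_graph c' &
              recourse pendant_graph pendant_coloring c' <= 2.
Proof.
move=> Dk q0; pose r0 := Ordinal q0.
have miss v : v \in e ->
    exists m : 'I_k, forall f, f \in E -> v \in f -> c f != Some m.
  move=> ve; pose S := [set f in E | v \in f] :\ e.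
  have Sk : #|S| < k.
    apply: leq_trans _ Dk; rewrite (leq_trans _ (leq_bigmax v)) // /degree.
    by rewrite [X in _ <= X](cardsD1 e) inE eE ve.
  have [/forallP H|/forallPn[m Hm]] :=
      boolP [forall m, Some m \in [set c f | f in S]].
    have : #|[set Some m | m : 'I_k]| <= #|S|.
      apply: leq_trans (leq_imset_card c _); apply: subset_leq_card.
      by apply/subsetP => x /imsetP[m _ ->].
    by rewrite (card_imset _ Some_inj) card_ord leqNgt Sk.
  exists m => f fE vf; apply: contraNneq Hm => cf; rewrite -cf imset_f //.
  by rewrite !inE fE vf andbT -c_none // cf.
have [mu muP] : exists mu : V -> 'I_k, forall v f,
    v \in e -> f \in E -> v \in f -> c f != Some (mu v).
  have [v0 v0e] : exists v, v \in e.
    by apply/set0Pn; rewrite -card_gt0 edge_card ?eE.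
  have [m0 _] := miss _ v0e.
  (* The default [m0] is taken only where no color is missing, hence not at the ends of [e]. *)
  exists (fun v => odflt m0 [pick m | [forall f in E, (v \in f) ==> (c f != Some m)]]).
  move=> v f ve fE vf; case: pickP => [m /forall_inP/(_ f fE)|] /=.
    by rewrite vf.
  have [m mP] := miss v ve; move=> /(_ m)/forall_inP[] f' f'E.
  by apply/implyP; apply: mP.
pose a := [ffun f => if f == e then Some (rshift k r0)
                     else omap (@lshift k q) (c f)].
pose b v r := if (v \in e) && (r == r0) then lshift q (mu v) else rshift k r.
case/and3P: (cP) => _ /proper_coloringP cprop _.
exists (glue_coloring a b).
  apply/andP; split; last first.
    apply/forall_inP => F /pendant_graphP[f fE|v r]; last by rewrite glue_pendant.
    rewrite glue_core ffunE; case: eqP => // /eqP; rewrite -c_none //.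
    by case: (c f).
  apply: glue_proper => [|v r r'|f v r fE vf].
  - apply/proper_coloringP => f f' fE f'E adj _; rewrite !ffunE.
    have nff' : f != f' by case/andP: adj.
    have [fe|] := eqVneq f e; have [fe'|] := eqVneq f' e; rewrite -?c_none //.
    + by rewrite fe fe' eqxx in nff'.
    + by case: (c f') => //= i _; rewrite (inj_eq Some_inj) eq_rlshift.
    + by case: (c f) => //= i _; rewrite (inj_eq Some_inj) eq_lrshift.
    by rewrite omap_lshift_eq => _ cf; apply: cprop.
  - rewrite /b; case: (v \in e) => /=; last by move/rshift_inj.
    case: eqP => [->|_]; case: eqP => [->|_] //; last by move/rshift_inj.
      by move/eqP; rewrite eq_lrshift.
    by move/eqP; rewrite eq_rlshift.
  rewrite ffunE /b; have [fe|nfe] := eqVneq f e.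
    rewrite fe in vf; rewrite vf (inj_eq Some_inj) /=.
    case: (eqVneq r r0) => [_|]; first by rewrite eq_rlshift.
    by rewrite eq_rshift eq_sym.
  have := fun ve => muP v f ve fE vf; move: nfe; rewrite -c_none //.
  case: (c f) => //= i _; case: (v \in e) => /= [/(_ isT) H|_].
    by case: (r == r0); rewrite (inj_eq Some_inj) ?eq_lrshift // eq_lshift.
  by rewrite (inj_eq Some_inj) eq_lrshift.
(* Only the pendant edges of index [r0] at the two ends of [e] count: [e] was uncolored before. *)
rewrite -(edge_card _ eE); apply: leq_trans (leq_imset_card (pendant^~ r0) _).
apply: subset_leq_card; apply/subsetP => F; rewrite inE => /andP[].
case/pendant_graphP => [f fE|v r].
  rewrite pendant_coloring_core glue_core ffunE; have [->|_] := eqVneq f e.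
    by rewrite c_e.
  by rewrite eqxx andbF.
rewrite pendant_coloring_pendant glue_pendant /= (inj_eq Some_inj) /b.
case: ifP => [/andP[ve /eqP ->] _|_]; last by rewrite eqxx.
by apply/imsetP; exists v.
Qed.

(** Here [f] stands for the current position of the uncolored edge, which must stay in the core. *)
Definition shift_invariant (x : {ffun {set W} -> option 'I_(k + q)}) (f : {set V}) :=
  [/\ f \in E,
      forall f', f' \in E -> f' != f -> exists i, x (core_edge f') = Some (lshift q i) &
      forall v r, x (pendant v r) = Some (rshift k r)].

Lemma other_end f v : f \in E -> exists2 b, b \in f & b != v.
Proof.
move=> fE; have /subsetPn[b bf] : ~~ (f \subset [set v]).
  by apply/negP => /subset_leq_card; rewrite cards1 edge_card.
by rewrite inE; exists b.
Qed.

(** A chain cannot step from [core_edge f] to [pendant v r]: [core_edge f] would receive the fresh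
    color [r], still present on [pendant b r] at the other end [b] of [f]. So every step stays in
    the core and moves old colors only. *)
Lemma shift_invariantP p x f : shift_invariant x f ->
  chain pendant_graph (core_edge f) p ->
  shiftable pendant_graph x (core_edge f) p ->
  exists2 f', last (core_edge f) p = core_edge f' &
              shift_invariant (shift x (core_edge f) p) f'.
Proof.
elim: p x f => [|F' p IH] x f inv; first by exists f.
case/andP => /= /and3P[_ F'G allp] /andP[meet pathp] sh.
have [fE xcore xpend] := inv.
case/pendant_graphP: F'G allp meet pathp sh => [f' f'E|v r] allp meet pathp sh.
  (* Consecutive edges of a chain share exactly one vertex, whereas an edge meets itself in two. *)
  have nff' : f != f'.
    apply: contraTneq meet => ->.
    by rewrite setIid card_imset ?edge_card //; apply: coreI.
  apply: IH.
  - split=> // [f1 f1E nf1|v r].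
      rewrite !ffunE !(inj_eq core_edgeI) (negPf nf1).
      have [_|] := eqVneq f1 f; first by apply: xcore; rewrite // eq_sym.
      exact: xcore.
    by rewrite !ffunE ![pendant _ _ == _]eq_sym !core_edge_pendant.
  - by rewrite /chain /= core_edge_in // allp.
  - by move=> j; apply: (sh j.+1).
have vf : v \in f by rewrite -(core_pendant_meet f v r) -card_gt0 (eqP meet).
have [b bf nbv] := other_end f v fE.
have /proper_coloringP/(_ (pendant b r) (core_edge f)) := sh 1.
rewrite /= take0 /= pendant_in core_edge_in // => /(_ isT isT).
have nbv' : (pendant b r == pendant v r) = false.
  by apply/eqP => /pendantI[bv]; rewrite bv eqxx in nbv.
rewrite /adjacent eq_sym core_edge_pendant setIC core_pendant_meet bf => /(_ isT).
rewrite !ffunE nbv' [pendant b r == _]eq_sym !core_edge_pendant !xpend eqxx => /(_ isT).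
by rewrite eqxx.
Qed.

(** The last edge of the chain is a core edge, and its final color is old since its ends see all
    fresh colors. The core thus ends up fully colored with old colors, and [min_recourse E c] bounds
    the changes there. *)
Lemma pendant_shift_recourse c' :
  shift_based pendant_graph pendant_coloring (core_edge e) c' ->
  min_recourse E c <= recourse pendant_graph pendant_coloring c'.
Proof.
case=> p [chp shp _ [a una c'E]].
have [f lastE [fE xcore xpend]] :
    exists2 f', last (core_edge e) p = core_edge f' &
              shift_invariant (shift pendant_coloring (core_edge e) p) f'.
  apply: shift_invariantP => //; split=> [|f fE nfe|v r]; first exact: eE.
    rewrite pendant_coloring_core; move: nfe; rewrite -c_none //.
    by case: (c f) => // i _; exists i.
  by rewrite pendant_coloring_pendant.
set x := shift _ _ p in una c'E xcore xpend; rewrite lastE in una c'E.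
have /proper_coloringP xprop : proper_coloring pendant_graph x.
  by rewrite /x -[p in shift _ _ p]take_size; apply: shp.
have [b bf] : exists b, b \in f by apply/set0Pn; rewrite -card_gt0 edge_card.
have [i aE] : exists i, a = lshift q i.
  case: (splitP a) => [i|r] aE; first by exists i; apply/val_inj.
  have := forall_inP una _ (pendant_in b r).
  rewrite /adjacent core_edge_pendant core_pendant_meet bf xpend /=.
  by rewrite (_ : rshift k r = a) ?eqxx //; apply/val_inj.
have c'core f' : f' \in E -> exists j, c' (core_edge f') = Some (lshift q j).
  move=> f'E; rewrite c'E ffunE (inj_eq core_edgeI).
  by case: eqP => [_|/eqP]; [exists i; rewrite aE|apply: xcore].
have c'prop f1 f2 : f1 \in E -> f2 \in E -> adjacent f1 f2 ->
    c' (core_edge f1) != c' (core_edge f2).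
  move=> f1E f2E /andP[n12 meet].
  have adj : adjacent (core_edge f1) (core_edge f2).
    by rewrite /adjacent core_edge_meet meet andbT (inj_eq core_edgeI).
  rewrite c'E !ffunE !(inj_eq core_edgeI).
  have [f1f|nf1] := eqVneq f1 f; have [f2f|nf2] := eqVneq f2 f.
  - by rewrite f1f f2f eqxx in n12.
  - rewrite eq_sym; apply: implyP (forall_inP una _ (core_edge_in _ f2E)) _.
    by rewrite -f1f.
  - apply: implyP (forall_inP una _ (core_edge_in _ f1E)) _.
    by rewrite -f2f /adjacent eq_sym setIC.
  apply: xprop; rewrite ?core_edge_in //.
  by have [j ->] := xcore _ f1E nf1.
(* The default [None] is never taken on [E], where [c'] uses only old colors. *)
pose c2 : {ffun {set V} -> option 'I_k} :=
  [ffun f => obind (fun a => if split a is inl i then Some i else None)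
                   (c' (core_edge f))].
have c2E f' j : c' (core_edge f') = Some (lshift q j) -> c2 f' = Some j.
  move=> E1; rewrite ffunE E1 /=.
  by case: split_ordP => [j' /lshift_inj -> //|j' /eqP]; rewrite eq_lrshift.
have c2full : full_coloring E c2.
  apply/full_coloringP; split=> [f1 f2 f1E f2E adj|f1 f1E].
    have := c'prop _ _ f1E f2E adj.
    have [i1 E1] := c'core _ f1E; have [i2 E2] := c'core _ f2E.
    rewrite (c2E _ _ E1) (c2E _ _ E2) E1 E2.
    by rewrite -(omap_lshift_eq (Some i1) (Some i2)).
  by have [i1 E1] := c'core _ f1E; rewrite (c2E _ _ E1).
apply: leq_trans (@min_recourse_le _ _ _ _ _ c2full) _.
rewrite /recourse -(card_imset _ core_edgeI); apply: subset_leq_card.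
apply/subsetP => F /imsetP[f1]; rewrite inE => /and3P[f1E cf1 nc] ->.
rewrite inE core_edge_in // pendant_coloring_core.
have [i1 E1] := c'core _ f1E; rewrite (c2E _ _ E1) in nc.
rewrite E1 -[Some (lshift q i1)]/(omap (@lshift k q) (Some i1)) omap_lshift_eq nc.
by case: (c f1) cf1.
Qed.

End PendantEdges.

(** * The layered graph, its degrees and its recourse *)

Section Layers.
Local Open Scope nat_scope.
Variables (W : finType) (h g t : nat) (s : nat -> nat) (code : bool -> nat -> nat -> W).
Hypotheses (h_gt0 : 0 < h) (hg : h <= g) (t_ge2 : 2 <= t).
Hypotheses (s0 : s 0 = h) (s1 : s 1 = g).
Hypotheses (s_growth : forall i, s i * g <= h * s i.+1).
Hypothesis s_ge : forall i, g <= s i.+1.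
Hypothesis codeI : forall a i x a' i' x', i <= t -> x < s i -> i' <= t -> x' < s i' ->
  code a i x = code a' i' x' -> [/\ a = a', i = i' & x = x'].

(** The next layer is seen as a cycle on which the [g] edges leaving a vertex are spread evenly.
    This keeps the upward degrees at most [h], while each index [j] acts as a translation and so
    gives a matching. *)
Definition offset i j := (j * s i.+1) %/ g.
Definition below i j x := (x + offset i j) %% s i.+1.
Definition edge a i x j : {set W} := [set code a i x; code a i.+1 (below i j x)].
Definition root_edge : {set W} := [set code false 0 0; code true 0 0].
Definition is_edge (f : {set W}) a i x j := [/\ i < t, x < s i, j < g & f = edge a i x j].
Definition layers : {set {set W}} :=
  [set f | `[< f = root_edge \/ exists a i x j, is_edge f a i x j >]].

Let g_gt0 : 0 < g := leq_trans h_gt0 hg.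

Let s_mono i : s i <= s i.+1.
Proof.
have := s_growth i; have : h * s i.+1 <= g * s i.+1 by rewrite leq_mul2r hg orbT.
move=> H1 H2; have := leq_trans H2 H1.
by rewrite mulnC leq_pmul2l.
Qed.

Let sS_gt0 i : 0 < s i.+1.
Proof. exact: leq_trans (s_ge i). Qed.

Let s_gt0 i : 0 < s i.
Proof. by case: i => [|i]; rewrite ?s0 ?sS_gt0. Qed.

Lemma below_lt i j x : below i j x < s i.+1.
Proof. by rewrite ltn_mod sS_gt0. Qed.

Lemma offset_lt i j : j < g -> offset i j < s i.+1.
Proof. by move=> jg; rewrite ltn_divLR // mulnC ltn_pmul2l // sS_gt0. Qed.

(** Since [g <= s i.+1], raising [j] by one raises [j * s i.+1] by at least [g], hence the quotient
    by at least one. *)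
Lemma offset_inj i j j' : offset i j = offset i j' -> j = j'.
Proof.
rewrite /offset; have := s_ge i; move: (s i.+1) => S gS.
wlog jj' : j j' / j < j' => [H E|].
  by case: (ltngtP j j') => // l; [apply: H|apply/esym/H].
move=> E; exfalso; have : j * S + g <= j' * S.
  apply: leq_trans (_ : j.+1 * S <= _); last by rewrite leq_mul2r jj' orbT.
  by rewrite mulSn addnC leq_add2r.
by move=> /(leq_div2r g); rewrite divnDr // divnn g_gt0 E addn1 ltnn.
Qed.

Lemma below_injl i j x x' : x < s i -> x' < s i -> below i j x = below i j x' -> x = x'.
Proof.
move=> xs x's /eqP; rewrite /below eqn_modDr => /eqP.
by rewrite !modn_small // (leq_trans _ (s_mono i)).
Qed.

Lemma below_injr i j j' x : j < g -> j' < g -> below i j x = below i j' x -> j = j'.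
Proof.
move=> jg j'g /eqP; rewrite /below eqn_modDl => /eqP.
by rewrite !modn_small ?offset_lt // => /offset_inj.
Qed.

Lemma edgeI a i x j a' i' x' j' :
  i < t -> x < s i -> j < g -> i' < t -> x' < s i' -> j' < g ->
  edge a i x j = edge a' i' x' j' -> [/\ a = a', i = i', x = x' & j = j'].
Proof.
move=> it xs jg i't x's j'g E.
have := set21 (code a i x) (code a i.+1 (below i j x)).
rewrite -/(edge a i x j) E !inE => /orP[]/eqP/codeI[]; rewrite ?below_lt ?(ltnW it) ?(ltnW i't) //.
  move=> aa ii xx; subst a' i' x'; split=> //.
  have := set22 (code a i x) (code a i.+1 (below i j x)).
  rewrite -/(edge a i x j) E !inE => /orP[]/eqP/codeI[]; rewrite ?below_lt ?(ltnW it) ?(ltnW i't) //.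
    by move=> _ /eqP; rewrite -[X in _ == X]addn0 -addn1 eqn_add2l.
  by move=> _ _ /below_injr; apply.
move=> aa ii xx; subst a i x.
have := set21 (code a' i' x') (code a' i'.+1 (below i' j' x')).
rewrite -/(edge a' i' x' j') -E !inE => /orP[]/eqP/codeI[];
  rewrite ?below_lt ?(ltnW it) ?(ltnW i't) // => _; lia.
Qed.

Lemma edge_neq_root a i x j : i < t -> x < s i -> edge a i x j <> root_edge.
Proof.
move=> it xs E; have := set22 (code a i x) (code a i.+1 (below i j x)).
by rewrite -/(edge a i x j) E !inE => /orP[]/eqP/codeI[]; rewrite ?below_lt ?s_gt0.
Qed.

Lemma layersP f : f \in layers <-> f = root_edge \/ exists a i x j, is_edge f a i x j.
Proof. by rewrite inE; split => [/asboolP|?]; last apply/asboolP. Qed.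

Lemma edge_in a i x j : i < t -> x < s i -> j < g -> edge a i x j \in layers.
Proof. by move=> *; apply/layersP; right; exists a, i, x, j. Qed.

Lemma root_edge_in : root_edge \in layers.
Proof. by apply/layersP; left. Qed.

Lemma layers_simple : simple_graph layers.
Proof.
apply/forall_inP => f /layersP[->|[a [i [x [j [it xs jg ->]]]]]]; rewrite cards2.
  by case: (eqVneq (code _ _ _)) => // /codeI[]; rewrite ?s_gt0.
by case: (eqVneq (code _ _ _)) =>// /codeI[]; rewrite ?below_lt ?(ltnW it) //; lia.
Qed.

(* Writing J = j + g when offset j <= x and J = j otherwise, the admissible j are those whose J
   satisfies J * s i.+1 \in [lo, lo + s i * g), and distinct J in that window differ by less than h. *)
Lemma up_count i x : x < s i.+1 ->
  #|[set j : 'I_g | (x + s i.+1 - offset i j) %% s i.+1 < s i]| <= h.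
Proof.
move=> xS; set S := s i.+1 in xS *; set A := [set _ | _].
pose J (j : nat) := if offset i j <= x then j + g else j.
have Jlt (j : 'I_g) : (x + S - offset i j) %% S < s i ->
    (x + S).+1 * g <= J j * S + s i * g /\ J j * S < (x + S).+1 * g.
  have dv := divn_eq (j * S) g; have md := ltn_pmod (j * S) g_gt0.
  have os := offset_lt i j (ltn_ord j); rewrite -/S in os.
  rewrite -/(offset i j) in dv; rewrite /J; case: (leqP (offset i j) x) => ox.
    rewrite (_ : x + S - _ = x - offset i j + S); last lia.
    rewrite modnDr modn_small; last lia.
    move=> lt; have lt' : x.+1 <= offset i j + s i by lia.
    have l1 := leq_mul lt' (leqnn g); have l2 := leq_mul ox (leqnn g).
    by rewrite mulnDl (mulnC g S); split; lia.
  rewrite modn_small; last lia.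
  move=> lt; have lt' : (x + S).+1 <= offset i j + s i by lia.
  have os' : offset i j <= x + S by lia.
  have l1 := leq_mul lt' (leqnn g); have l2 := leq_mul os' (leqnn g).
  by split; lia.
rewrite -[X in _ <= X]card_ord.
have lth n : n %% h < h by rewrite ltn_mod.
(* The residue of [J j] modulo [h] determines [j], so there are at most [h] indices. *)
rewrite -(card_in_imset (f := fun j : 'I_g => Ordinal (lth (J j)))) ?max_card //.
move=> j j'; rewrite !inE => /Jlt [l1 l2] /Jlt [l1' l2'] /(congr1 val) /= JJ.
have wl (a b : nat) : a %% h = b %% h -> (x + S).+1 * g <= a * S + s i * g ->
    b * S < (x + S).+1 * g -> b <= a.
  move=> ab la lb; rewrite leqNgt; apply/negP => lab.
  have hab : h %| b - a by rewrite -eqn_mod_dvd 1?ltnW // ab.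
  have hab' : h <= b - a by rewrite dvdn_leq // subn_gt0.
  have : (a + h) * S <= b * S by rewrite leq_mul2r; apply/orP; right; lia.
  have := s_growth i; rewrite -/S mulnDl; lia.
have JE : J j = J j'.
  by apply/eqP; rewrite eqn_leq; apply/andP; split; [apply: (wl _ _ (esym JJ))|apply: (wl _ _ JJ)].
apply/val_inj => /=; move: JE; rewrite /J.
have := ltn_ord j; have := ltn_ord j'.
by case: ifP => _; case: ifP => _; lia.
Qed.

Definition down_edges a i x := [set edge a i x j | j : 'I_g].
(** The upper end is found by subtracting the offset cyclically; adding [s i.+1] first keeps the
    subtraction from being truncated. *)
Definition up_edges a i x :=
  [set edge a i ((x + s i.+1 - offset i j) %% s i.+1) j
     | j : 'I_g in [set j : 'I_g | (x + s i.+1 - offset i j) %% s i.+1 < s i]].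

Lemma incident_cases f a i x : f \in layers -> i <= t -> x < s i -> code a i x \in f ->
  [\/ (f = root_edge) /\ i = 0, (i < t) && (f \in down_edges a i x) |
      exists2 i', i = i'.+1 & f \in up_edges a i' x].
Proof.
move=> /layersP[->|[a' [i' [x' [j [i't x's jg ->]]]]]] it xs; rewrite !inE.
  by case/orP => /eqP/codeI[]; rewrite ?s_gt0 // => _ i0 _; constructor 1.
case/orP => /eqP/codeI[]; rewrite ?below_lt ?(ltnW i't) // => aa ii xx; subst a' x.
  by subst i'; constructor 2; rewrite i't; apply/imsetP; exists (Ordinal jg).
subst i; constructor 3; exists i' => //.
have xE : (below i' j x' + s i'.+1 - offset i' j) %% s i'.+1 = x'.
  have os := offset_lt i' j jg.
  rewrite -addnBA 1?ltnW // /below modnDml -addnA subnKC 1?ltnW // modnDr.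
  by rewrite modn_small // (leq_trans x's (s_mono i')).
apply/imsetP; exists (Ordinal jg) => /=; first by rewrite inE /= xE.
by rewrite xE.
Qed.

Lemma degree_le w : degree layers w <= h + g.
Proof.
have [[a [i [x [it xs ->]]]]|H] :=
    pselect (exists a i x, [/\ i <= t, x < s i & w = code a i x]); last first.
  rewrite /degree (_ : [set _ in _ | _] = set0) ?cards0 //.
  apply/setP => f; rewrite in_set [RHS]inE; apply/negP => /andP[/layersP[->|]].
    rewrite !inE => /orP[]/eqP wE; apply: H.
      by exists false, 0, 0; rewrite s_gt0.
    by exists true, 0, 0; rewrite s_gt0.
  move=> [a [i [x [j [it xs jg ->]]]]]; rewrite !inE => /orP[]/eqP wE; apply: H.
    by exists a, i, x; rewrite ltnW.
  by exists a, i.+1, (below i j x); rewrite below_lt.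
rewrite /degree; case: i it xs => [|i] it xs.
  (* A top vertex has at most [root_edge] besides its downward edges, and [1 <= h]. *)
  apply: (@leq_trans #|root_edge |: down_edges a 0 x|).
    apply: subset_leq_card; apply/subsetP => f; rewrite in_set => /andP[fE wf].
    case: (incident_cases f a 0 x fE it xs wf) => [[-> _]|/andP[_ fd]|[i' //]].
      by rewrite !inE eqxx.
    by rewrite in_setU fd orbT.
  rewrite (leq_trans (leq_card_setU _ _)) // cards1 leq_add //.
  by rewrite (leq_trans (leq_imset_card _ _)) // card_ord.
apply: (@leq_trans #|up_edges a i x :|: down_edges a i.+1 x|).
  apply: subset_leq_card; apply/subsetP => f; rewrite in_set => /andP[fE wf].
  case: (incident_cases f a i.+1 x fE it xs wf) => [[_ //]|/andP[_ fd]|[i' [<-] fu]].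
    by rewrite in_setU fd orbT.
  by rewrite in_setU fu.
rewrite (leq_trans (leq_card_setU _ _)) // leq_add //.
  by rewrite (leq_trans (leq_imset_card _ _)) // up_count.
by rewrite (leq_trans (leq_imset_card _ _)) // card_ord.
Qed.

(** Between the layers of sizes [h] and [g] the offset of [j] is [j], so vertex 0 of layer 1 is
    joined to all [h] vertices above it; [2 <= t] provides its [g] edges downwards. *)
Lemma degree_ge : h + g <= degree layers (code false 1 0).
Proof.
have t0 : 0 < t by apply: ltnW.
have os j : offset 0 j = j by rewrite /offset s1 mulnK.
pose up (x : 'I_h) := edge false 0 x ((g - x) %% g).
have jg (x : 'I_h) : (g - x) %% g < g by rewrite ltn_mod.
have xs (x : 'I_h) : x < s 0 by rewrite s0.
have bel (x : 'I_h) : below 0 ((g - x) %% g) x = 0.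
  rewrite /below os s1 modnDmr subnKC ?modnn //.
  exact: leq_trans (ltnW (ltn_ord x)) hg.
have upI : injective up.
  by move=> x x' /edgeI[] // _ _ /val_inj.
have downI : injective (fun j : 'I_g => edge false 1 0 j).
  by move=> j j' /edgeI[]; rewrite ?sS_gt0 // => _ _ _ /val_inj.
rewrite -[X in X + _]card_ord -[X in _ + X]card_ord -!cardsT.
rewrite -(card_imset _ upI) -(card_imset _ downI) -cardsUI.
rewrite [X in _ + X](_ : _ = 0) ?addn0; last first.
  apply/eqP; rewrite cards_eq0; apply/eqP/setP => f; rewrite !inE.
  apply/negP => /andP[/imsetP[x _ ->] /imsetP[j _]].
  by move/edgeI=> []; rewrite ?sS_gt0.
apply: subset_leq_card; apply/subsetP => f fU; rewrite in_set.
case/setUP: fU => /imsetP[x _ ->].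
  by rewrite edge_in // /up /edge bel set22.
by rewrite edge_in ?sS_gt0 // set21.
Qed.

Lemma layers_max_degree : max_degree layers = h + g.
Proof.
apply/eqP; rewrite eqn_leq; apply/andP; split.
  by apply/bigmax_leqP => w _; apply: degree_le.
exact: leq_trans degree_ge (bigop.leq_bigmax _).
Qed.

(* The colors of the cut below layer i on side a are those of type odd i (+) tau a; the partial
   coloring has tau = id, so that the two ends of root_edge miss no common color. *)
Definition color_nat (tau : bool -> bool) a i j : nat := (odd i (+) tau a) * g + j.

Definition layer_coloring tau (z : option nat) : {ffun {set W} -> option 'I_(g + g)} :=
  [ffun f => [pick y : 'I_(g + g) | `[< (f = root_edge /\ z = Some (val y)) \/
     exists a i x j, is_edge f a i x j /\ val y = color_nat tau a i j >]]].

Lemma color_nat_lt tau a i j : j < g -> color_nat tau a i j < g + g.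
Proof. by rewrite /color_nat; case: (_ (+) _) => jg; lia. Qed.

Lemma layer_coloring_edge tau z a i x j : i < t -> x < s i -> j < g ->
  exists2 y, layer_coloring tau z (edge a i x j) = Some y & val y = color_nat tau a i j.
Proof.
move=> it xs jg; rewrite ffunE; case: pickP => [y /asboolP[[/edge_neq_root []//]|]|].
  move=> [a' [i' [x' [j' [[i't x's j'g /edgeI[]// -> -> _ ->] yE]]]]].
  by exists y.
move=> /(_ (Ordinal (color_nat_lt tau a i j jg)))/asboolP[]; right.
by exists a, i, x, j.
Qed.

Lemma layer_coloring_root tau z : (forall m, z = Some m -> m < g + g) ->
  omap val (layer_coloring tau z root_edge) = z.
Proof.
move=> zlt; rewrite ffunE; case: pickP => [y /asboolP[[_ -> //]|]|H].
  by move=> [a [i [x [j [[it xs _ /esym/edge_neq_root[]]]]]]].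
case: z zlt H => // m /(_ _ erefl) mlt /(_ (Ordinal mlt))/asboolP[].
by left.
Qed.

Lemma color_nat_inj tau a i j i' j' : j < g -> j' < g ->
  color_nat tau a i j = color_nat tau a i' j' -> odd i = odd i' /\ j = j'.
Proof.
by rewrite /color_nat; case: (odd i); case: (odd i'); case: (tau a) => /=; lia.
Qed.

(** With a common upper end, the color gives the index and thus the edge. In consecutive cuts the
    types differ. With a common lower end, equal indices give equal upper ends, translations being
    injective. *)
Lemma edge_meet_color tau a i x j a' i' x' j' w :
  i < t -> x < s i -> j < g -> i' < t -> x' < s i' -> j' < g ->
  w \in edge a i x j -> w \in edge a' i' x' j' ->
  color_nat tau a i j = color_nat tau a' i' j' -> edge a i x j = edge a' i' x' j'.
Proof.
move=> it xs jg i't x's j'g; rewrite !inE.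
case/orP => /eqP -> /orP[] /eqP /codeI[]; rewrite ?below_lt ?(ltnW it) ?(ltnW i't) //.
- by move=> -> -> -> /color_nat_inj[] // _ ->.
- by move=> -> -> _ /color_nat_inj[] //= H; case: (odd i') H.
- by move=> -> <- _ /color_nat_inj[] //= H; case: (odd i) H.
by move=> -> [ii]; subst i' => bb /color_nat_inj[] // _ jj; subst j'; rewrite (below_injl _ _ _ _ xs x's bb).
Qed.

Lemma layer_coloring_proper tau z :
  (forall m, z = Some m -> m < g + g) ->
  (forall a j, j < g -> z <> Some (color_nat tau a 0 j)) ->
  proper_coloring layers (layer_coloring tau z).
Proof.
move=> zlt zP.
have root_edgeP a i x j w : i < t -> x < s i -> j < g -> w \in root_edge -> w \in edge a i x j ->
    layer_coloring tau z root_edge != layer_coloring tau z (edge a i x j).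
  move=> it xs jg we0 wf.
  have [y yE yv] := layer_coloring_edge tau z a i x j it xs jg.
  apply/eqP => /(congr1 (omap val)); rewrite layer_coloring_root // yE /= yv.
  suff -> : i = 0 by apply: zP.
  move: wf; rewrite !inE => /orP[]/eqP wE; move: we0; rewrite wE !inE;
    by case/orP => /eqP/codeI[]; rewrite ?s_gt0 ?below_lt ?(ltnW it).
apply/proper_coloringP => f f' /layersP fE /layersP f'E /andP[nff' /set0Pn[w]].
case/setIP.
case: fE nff' => [->|[a [i [x [j [it xs jg ->]]]]]].
  case: f'E => [->|[a' [i' [x' [j' [i't x's j'g ->]]]]]]; first by rewrite eqxx.
  by move=> _ wf wf' _; apply: root_edgeP wf wf'.
case: f'E => [->|[a' [i' [x' [j' [i't x's j'g ->]]]]]] nff' wf wf' _.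
  by rewrite eq_sym; apply: root_edgeP wf' wf.
have [y -> yv] := layer_coloring_edge tau z a i x j it xs jg.
have [y' -> yv'] := layer_coloring_edge tau z a' i' x' j' i't x's j'g.
apply: contraNneq nff' => -[yy]; apply/eqP.
by apply: (edge_meet_color tau) wf wf' _ => //; rewrite -yv -yv' yy.
Qed.

Definition partial_layers := layer_coloring id None.

Lemma partial_layers_colored_except : colored_except layers partial_layers root_edge.
Proof.
apply/and3P; split; [exact: root_edge_in|exact: layer_coloring_proper|].
apply/forall_inP => f /layersP[->|[a [i [x [j [it xs jg ->]]]]]].
  have : omap val (partial_layers root_edge) = None by apply: layer_coloring_root.
  by case: (partial_layers root_edge) => // _; rewrite !eqxx.
have [y yE _] := layer_coloring_edge id None a i x j it xs jg.
rewrite /partial_layers yE.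
by apply/eqP/esym/eqP; apply: edge_neq_root.
Qed.

(** Exchanging the types on one side makes both top cuts use the colors below [g], so that [g] is
    free for [root_edge]. This puts the graph in the range of the maximum defining
    [worst_recourse]. *)
Lemma layers_full : full_coloring layers (layer_coloring (fun=> false) (Some g)).
Proof.
have zlt m : Some g = Some m -> m < g + g by move=> [<-]; lia.
apply/andP; split.
  by apply: layer_coloring_proper => // a j jg [] /=; rewrite /color_nat /=; lia.
apply/forall_inP => f /layersP[->|[a [i [x [j [it xs jg ->]]]]]].
  have := layer_coloring_root (fun=> false) (Some g) zlt.
  by case: (layer_coloring _ _ _).
by have [y -> _] := layer_coloring_edge (fun=> false) (Some g) a i x j it xs jg.
Qed.

Definition type_of (o : option 'I_(g + g)) := if o is Some y then g <= y else false.

(** Restricting to the lower cuts lets each step of the cascade contribute an edge that the later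
    steps do not count. *)
Definition changed_from c' i := [set f in layers | [&& partial_layers f != None,
  c' f != partial_layers f &
  `[< exists a i' x j, is_edge f a i' x j /\ i <= i' >]]].

(* If an edge entering a vertex from above has the type of the g edges below it, these g edges
   cannot all keep their type, since there are only g colors of that type. *)
Lemma cascade c' d : full_coloring layers c' -> forall a i x f, i + d = t -> x < s i ->
  f \in layers -> code a i x \in f -> (forall j, i < t -> j < g -> f <> edge a i x j) ->
  type_of (c' f) = odd i (+) a -> d <= #|changed_from c' i|.
Proof.
case/full_coloringP => c'P c'N.
elim: d => // d IH a i x f id_t xs fE wf nf tf.
have it : i < t by lia.
have [j tj] : exists j : 'I_g, type_of (c' (edge a i x j)) != odd i (+) a.
  apply/existsP; rewrite -[X in is_true X]negbK; apply/negP => /existsPn H.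
  have {}H (j : 'I_g) : type_of (c' (edge a i x j)) = type_of (c' f).
    by rewrite tf; apply/eqP; rewrite -[_ == _]negbK H.
  (* Within one type, a color is determined by its residue modulo [g]. *)
  pose idx o := if o is Some y then Ordinal (ltn_pmod (val (y : 'I_(g + g))) g_gt0)
                else Ordinal g_gt0.
  have sm (z : 'I_(g + g)) : g <= z -> z %% g = z - g.
    move=> gz; rewrite -{1}(subnK gz) modnDr modn_small //.
    by have := ltn_ord z; lia.
  have idxI F F' : F \in layers -> F' \in layers -> type_of (c' F) = type_of (c' F') ->
      idx (c' F) = idx (c' F') -> c' F = c' F'.
    move=> FE F'E; have := c'N _ FE; have := c'N _ F'E.
    case: (c' F) => // y; case: (c' F') => // y' _ _ /= yy /(congr1 val)/= mm.
    congr Some; apply/val_inj => /=.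
    have := ltn_ord y; have := ltn_ord y'; move: yy mm.
    case: (leqP g y) => gy; case: (leqP g y') => gy' // _; last first.
      by rewrite !modn_small.
    by rewrite !sm //; lia.
  have injd : injective (fun j : 'I_g => idx (c' (edge a i x j))).
    move=> j j' /idxI; rewrite !edge_in // !H => /(_ isT isT erefl) cc.
    apply/eqP/negP => njj'.
    have : adjacent (edge a i x j) (edge a i x j').
      apply/andP; split; last by apply/set0Pn; exists (code a i x); rewrite !inE eqxx.
      by apply: contra_notN njj' => /eqP/edgeI[]// _ _ _ /val_inj ->.
    by move/c'P; rewrite !edge_in // cc eqxx => /(_ isT isT).
  (* The [g] edges below exhaust the residues, so one of them has the color of [f]. *)
  have [j jE] : exists j : 'I_g, idx (c' f) = idx (c' (edge a i x j)).
    have /codomP[j ->] : idx (c' f) \in codom (fun j : 'I_g => idx (c' (edge a i x j))).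
      by rewrite (inj_card_onto injd).
    by exists j.
  have := idxI _ _ fE (edge_in a i x j it xs (ltn_ord j)) (esym (H j)) jE.
  apply/eqP; apply: c'P; rewrite ?edge_in //; apply/andP; split; first by apply/eqP/nf.
  by apply/set0Pn; exists (code a i x); rewrite !inE wf eqxx.
have [y yE yv] := layer_coloring_edge id None a i x j it xs (ltn_ord j).
have ty : type_of (Some y) = odd i (+) a.
  by rewrite /= yv /color_nat; have := ltn_ord j; case: (_ (+) _) => /=; lia.
(* Having left the type of its own cut, the edge has the type of the next parity, as the induction
   requires. *)
have IHd : d <= #|changed_from c' i.+1|.
  apply: (IH a i.+1 (below i j x) (edge a i x j)).
  - lia.
  - exact: below_lt.
  - exact: edge_in.
  - exact: set22.
  - by move=> j' i1t j'g /edgeI[]; rewrite ?below_lt //; lia.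
  by rewrite oddS; move: tj; case: (type_of _); case: (odd i); case: (a).
apply: (@leq_ltn_trans #|changed_from c' i.+1|) => //.
apply: proper_card; apply/properP; split.
  apply/subsetP => F; rewrite !in_set => /and4P[-> -> ->].
  move=> /asboolP[a' [i' [x' [j' [isF ii']]]]].
  by apply/asboolP; exists a', i', x', j'; split; last exact: ltnW.
exists (edge a i x j).
  rewrite in_set edge_in // /partial_layers yE /=; apply/andP; split.
    by apply: contraNneq tj => ->; rewrite ty.
  by apply/asboolP; exists a, i, x, j.
rewrite in_set; apply/negP => /and4P[_ _ _].
move=> /asboolP[a' [i' [x' [j' [[i't x's j'g /edgeI[]// _ <- _ _]]]]]].
by rewrite ltnn.
Qed.

(** The side [a] is the type of the new color of [root_edge]: on that side the top cut has this very
    type, and the cascade passes through all [t] cuts. *)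
Lemma layers_recourse c' : full_coloring layers c' -> t <= recourse layers partial_layers c'.
Proof.
move=> c'full; pose a := type_of (c' root_edge).
apply: (@leq_trans #|changed_from c' 0|).
  apply: (cascade c' t c'full a 0 0 root_edge); rewrite ?s_gt0 ?root_edge_in //.
    by rewrite /root_edge; case: (a); rewrite ?set21 ?set22.
  by move=> j _ jg /esym/edge_neq_root; apply; rewrite ?s_gt0 // ltnW.
apply: subset_leq_card; apply/subsetP => f.
by rewrite !in_set => /and4P[-> -> ->].
Qed.

End Layers.

(** * Instances with large recourse *)

Section Instances.
Local Open Scope nat_scope.

(** Positivity excludes the value 0 of an empty maximum. *)
Lemma bigmax_attained (I : eqType) (r : seq I) (P : pred I) (F : I -> nat) :
  0 < \max_(i <- r | P i) F i ->
  exists i, [/\ i \in r, P i & \max_(i <- r | P i) F i = F i].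
Proof.
elim: r => [|i r IH]; first by rewrite big_nil.
rewrite big_cons; case: ifP => [Pi|_]; last first.
  by move=> /IH[j [jr Pj E]]; exists j; rewrite inE jr orbT.
case: (leqP (\max_(j <- r | P j) F j) (F i)) => [le _|lt _]; last first.
  have [j [jr Pj E]] := IH (leq_ltn_trans (leq0n _) lt).
  by exists j; rewrite inE jr orbT.
by exists i; rewrite inE eqxx.
Qed.

Lemma card_leq_inj (A B : finType) : #|A| <= #|B| -> exists f : A -> B, injective f.
Proof.
move=> AB; exists (fun x => enum_val (widen_ord AB (enum_rank x))).
by move=> x y /enum_val_inj/(congr1 val) E; apply/enum_rank_inj/val_inj.
Qed.

Lemma recolor_none (V : finType) k (E : {set {set V}}) (c : {ffun {set V} -> option 'I_k}) e :
  full_coloring E c -> e \in E ->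
  colored_except E (recolor c e None) e /\ recourse E (recolor c e None) c = 0.
Proof.
case/full_coloringP => cP cN eE; split.
  apply/and3P; split=> //; last first.
    apply/forall_inP => f fE; rewrite ffunE; case: (f == e) => //.
    by rewrite (negPf (cN _ fE)).
  apply/proper_coloringP => f f' fE f'E adj; rewrite !ffunE.
  by case: (f == e) => // cf; case: (f' == e) => //; apply: cP.
apply/eqP; rewrite cards_eq0; apply/eqP/setP => f; rewrite !inE ffunE.
by case: (f == e); rewrite ?eqxx ?andbF.
Qed.

(** This is for the case where the maximum of the worst-case recourses is 0: the lower bound is then
    trivial, but a graph of maximum degree [D] is still due. A star is a pendant graph over a single
    vertex. *)
Lemma star_instance (W : finType) D k : 0 < D -> D <= k -> D < #|W| ->
  exists (G : {set {set W}}) (e : {set W}) (col : {ffun {set W} -> option 'I_k}),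
  [/\ simple_graph G, max_degree G = D, colored_except G col e &
      exists2 col', full_coloring G col' & recourse G col col' <= 2].
Proof.
move=> D0 Dk DW.
have [cod codI] : exists cod : unit * option 'I_D -> W, injective cod.
  by apply: card_leq_inj; rewrite card_prod card_unit card_option card_ord mul1n.
have s0 : simple_graph (set0 : {set {set unit}}) by apply/forall_inP => f; rewrite inE.
pose G := pendant_graph unit W D cod set0.
have d0 : max_degree (set0 : {set {set unit}}) = 0.
  rewrite /max_degree big1 // => v _; rewrite /degree (_ : [set _ in _ | _] = set0) ?cards0 //.
  by apply/setP => f; rewrite !inE.
pose c : {ffun {set unit} -> option 'I_k} := [ffun=> None].
pose full : {ffun {set W} -> option 'I_k} :=
  glue_coloring unit W D cod c (fun _ r => widen_ord Dk r).
have fullP : full_coloring G full.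
  apply/andP; split.
    apply: glue_proper => //.
    - by apply/proper_coloringP => f; rewrite inE.
    - by move=> v r r' /(congr1 val) rr'; apply: val_inj.
    - by move=> f v r; rewrite inE.
  apply/forall_inP => F FG; case: (pendant_graphP _ _ _ _ _ _ FG) => [f|v r].
    by rewrite inE.
  by rewrite glue_pendant.
pose e := pendant unit W D cod tt (Ordinal D0).
have [ce rec0] := recolor_none _ _ _ _ e fullP (pendant_in _ _ _ _ _ _ _).
exists G, e, (recolor full e None); split=> //.
- exact: pendant_graph_simple.
- by rewrite /G pendant_graph_max_degree ?d0 // card_unit.
by exists full; rewrite // rec0.
Qed.

Lemma pendant_instance (V W : finType) D k q K Delta (E : {set {set V}})
    (c : {ffun {set V} -> option 'I_k}) (e : {set V}) :
  K = k + q -> Delta = D + q -> 0 < q -> D <= k -> #|V| * q.+1 <= #|W| ->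
  simple_graph E -> max_degree E = D -> colored_except E c e ->
  exists (G : {set {set W}}) (e' : {set W}) (col : {ffun {set W} -> option 'I_K}),
  [/\ simple_graph G, max_degree G = Delta, colored_except G col e',
      exists2 col', full_coloring G col' & recourse G col col' <= 2 &
      forall col', shift_based G col e' col' -> min_recourse E c <= recourse G col col'].
Proof.
move=> -> -> q0 Dk VW sE dE ce.
have [cod codI] : exists cod : V * option 'I_q -> W, injective cod.
  by apply: card_leq_inj; rewrite card_prod card_option card_ord.
exists (pendant_graph V W q cod E), (core_edge V W q cod e), (pendant_coloring V W k q cod c).
split.
- exact: pendant_graph_simple.
- rewrite pendant_graph_max_degree ?dE ?addn_gt0 ?q0 ?orbT //.
  have eE : e \in E by case/and3P: ce.
  have : 0 < #|e| by rewrite (eqP (forall_inP sE _ eE)).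
  by rewrite card_gt0 => /set0Pn[v _]; apply/card_gt0P; exists v.
- exact: pendant_coloring_colored_except.
- by apply: (pendant_extend _ _ _ _ _ codI E sE c e ce); rewrite ?dE.
by move=> col'; apply: pendant_shift_recourse.
Qed.

Lemma recourse_instance Delta C n : 3 <= Delta -> C <= Delta - 3 ->
  exists (G : {set {set 'I_(maxn n Delta.+1)}}) (e : {set 'I_(maxn n Delta.+1)})
         (col : {ffun {set 'I_(maxn n Delta.+1)} -> option 'I_(Delta + C)}),
  [/\ simple_graph G, max_degree G = Delta, colored_except G col e,
      exists2 col', full_coloring G col' & recourse G col col' <= 2 &
      forall col', shift_based G col e col' ->
        \max_(1 <= q < (Delta - C - 2).+1) worst_recourse (n %/ q.+1) (Delta - q) C
          <= recourse G col col'].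
Proof.
move=> D3 CD; set M := \max_(_ <= _ < _) _.
have [M0|Mpos] := posnP M.
  have [G [e [col [H1 H2 H3 H4]]]] := star_instance 'I_(maxn n Delta.+1) Delta (Delta + C)
    ltac:(lia) (leq_addr _ _) ltac:(by rewrite card_ord leq_maxr).
  by exists G, e, col; split=> // col' _; rewrite M0.
(* A positive maximum is attained at some [q], then at a graph, then at a partial coloring. *)
have [q [qr _ ME]] := bigmax_attained _ _ _ _ Mpos; rewrite -/M in ME.
rewrite mem_index_iota in qr.
rewrite ME in Mpos *; rewrite /worst_recourse in Mpos *.
have [E [_ /and3P[sE /eqP dE _] EE]] := bigmax_attained _ _ _ _ Mpos.
rewrite EE in Mpos *.
have [c [_ /existsP[e ce] cE]] := bigmax_attained _ _ _ _ Mpos.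
rewrite cE; apply: (pendant_instance _ _ (Delta - q) (Delta - q + C) q _ _ E c e) => //.
- lia.
- lia.
- lia.
- exact: leq_addr.
by rewrite !card_ord; apply: leq_trans (leq_trunc_div _ _) (leq_maxl _ _).
Qed.

Lemma layers_worst_recourse h t C N s : let g := h + C in
  0 < h -> 2 <= t -> s 0 = h -> s 1 = g -> (forall i, s i * g <= h * s i.+1) ->
  (forall i, g <= s i.+1) -> (\sum_(i < t.+1) s i).*2 <= N ->
  t <= worst_recourse N (h + g) C.
Proof.
move=> g h0 t2 s0 s1 sg sge tN.
pose off i := \sum_(k < i) s k.
have off_mono i j : i <= j -> off i <= off j.
  move=> /subnK <-; elim: (j - i) => // d IH.
  by rewrite addSn /off big_ord_recr /= (leq_trans IH) // leq_addr.
have offS i : off i.+1 = off i + s i by rewrite /off big_ord_recr.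
have N0 : 0 < N.
  by apply: leq_trans tN; rewrite double_gt0 big_ord_recl /= s0 addn_gt0 h0.
(* Layers are laid out consecutively, side [true] after side [false]; actual vertices land below
   [N], so they never meet the default of [insubd]. *)
pose pos (a : bool) i x := a * off t.+1 + (off i + x).
have offlt i x : i <= t -> x < s i -> off i + x < off t.+1.
  move=> it xs; apply: leq_trans (off_mono i.+1 t.+1 it).
  by rewrite offS ltn_add2l.
have poslt a i x : i <= t -> x < s i -> pos a i x < N.
  move=> it xs; apply: leq_trans tN; have := offlt _ _ it xs.
  by rewrite /pos -/(off t.+1) -addnn; case: a => /=; lia.
pose code a i x : 'I_N := insubd (Ordinal N0) (pos a i x).
have codeI a i x a' i' x' : i <= t -> x < s i -> i' <= t -> x' < s i' ->
    code a i x = code a' i' x' -> [/\ a = a', i = i' & x = x'].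
  move=> it xs i't x's /(congr1 val); rewrite !val_insubd !poslt // /pos => E.
  have l1 := offlt _ _ it xs; have l2 := offlt _ _ i't x's.
  have aa : a = a' by case: a a' E => -[] //=; lia.
  subst a'; have {}E : off i + x = off i' + x' by lia.
  have ii : i = i'.
    case: (ltngtP i i') => // lt.
      by have := off_mono i.+1 i' lt; rewrite offS; lia.
    by have := off_mono i'.+1 i lt; rewrite offS; lia.
  by subst i'; split=> //; lia.
have hg : h <= g by apply: leq_addr.
apply: (@worst_recourse_ge _ _ _ (g + g) _ (layers _ g t s code)
  (partial_layers _ g t s code) (layer_coloring _ g t s code (fun=> false) (Some g))
  (root_edge _ code)).
- by rewrite /g; lia.
- exact: (layers_simple _ h g t s code).
- exact: (layers_max_degree _ h g t s code).
- exact: (layers_full _ h g t s code).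
- exact: (partial_layers_colored_except _ h g t s code).
exact: (layers_recourse _ h g t s code).
Qed.

(* The least sizes satisfying layer_size_growth. *)
Fixpoint layer_size h g i := if i is i'.+1 then (layer_size h g i' * g + h.-1) %/ h else h.

Section LayerSize.
Variables (h g : nat).
Hypotheses (h_gt0 : 0 < h) (hg : h <= g).

Lemma layer_size1 : layer_size h g 1 = g.
Proof. by rewrite /= mulnC divnMDl // divn_small ?addn0 // prednK. Qed.

Lemma layer_size_growth i : layer_size h g i * g <= h * layer_size h g i.+1.
Proof.
rewrite /=; set a := _ * g; have := divn_eq (a + h.-1) h.
have := ltn_pmod (a + h.-1) h_gt0; lia.
Qed.

Lemma layer_size_growth_le i : h * layer_size h g i.+1 <= layer_size h g i * g + h.-1.
Proof. by rewrite /= mulnC leq_trunc_div. Qed.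

Lemma layer_size_ge i : g <= layer_size h g i.+1.
Proof.
have /(_ i) H : forall i, h <= layer_size h g i.
  elim=> // j IH; apply: leq_trans hg _; rewrite /= leq_divRL // mulnC.
  by rewrite (leq_trans _ (leq_addr _ _)) // leq_mul2r IH orbT.
rewrite /= leq_divRL // mulnC.
by rewrite (leq_trans _ (leq_addr _ _)) // leq_mul2r H orbT.
Qed.

End LayerSize.

Lemma layer_size_worst_recourse h t C N : 0 < h -> 2 <= t ->
  (\sum_(i < t.+1) layer_size h (h + C) i).*2 <= N ->
  t <= worst_recourse N (h + (h + C)) C.
Proof.
move=> h0 t2; have hg := leq_addr C h; apply: layers_worst_recourse => //.
- exact: layer_size1.
- by move=> i; apply: layer_size_growth.
by move=> i; apply: layer_size_ge.
Qed.

(** With [h = 1] and [C = 0] the growth factor is 1, so layers of one vertex suffice: two paths of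
    [t.+1] vertices joined by the uncolored edge. *)
Lemma path_worst_recourse t N : 2 <= t -> t.+1.*2 <= N -> t <= worst_recourse N 2 0.
Proof.
move=> t2 tN; apply: (@layers_worst_recourse 1 t 0 N (fun=> 1)) => //.
by rewrite sum1_card card_ord.
Qed.

End Instances.

(** * Asymptotic estimates *)

Section Asymptotics.
Variable R : realType.

(** Three squarings, each by [2 * (y - 1) <= y ^+ 2 - 1]. The eighth power costs a constant factor
    in the number of layers and absorbs the constants of the vertex count. *)
Lemma bernoulli8 (x : R) : 1 <= x -> 8%:R * (x - 1) <= x ^+ 8 - 1.
Proof.
move=> x1; have H (y : R) : 1 <= y -> 2 * (y - 1) <= y ^+ 2 - 1 by move=> y1; nra.
have x2 : 1 <= x ^+ 2 by rewrite exprn_ege1.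
have x4 : 1 <= x ^+ 2 ^+ 2 by rewrite exprn_ege1.
rewrite (_ : x ^+ 8 = x ^+ 2 ^+ 2 ^+ 2); last by rewrite -!exprM.
have := H _ x1; have := H _ x2; have := H _ x4; lra.
Qed.

(** A geometric sum of ratio [rho = (h + C) / h], where [rho - 1 = C / h]; the factor 2 bounds
    [(C + 1) / C]. *)
Lemma layer_size_sum h C m : (0 < h)%N -> (0 < C)%N ->
  C%:R * (\sum_(i < m) layer_size h (h + C) i)%N%:R
    <= 2 * h%:R ^+ 2 * (((h + C)%:R / h%:R) ^+ m - 1) :> R.
Proof.
move=> h0 C0; set rho : R := _ / _.
have hR : 0 < h%:R :> R by rewrite ltr0n.
have CR : 1 <= C%:R :> R by rewrite ler1n.
have rhoE : rho * h%:R = h%:R + C%:R by rewrite /rho divfK ?lt0r_neq0 // natrD.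
have rho0 : 0 < rho by rewrite divr_gt0 // ltr0n addn_gt0 h0.
(* Adding [h] absorbs the rounding: the left-hand side grows at most by the factor [rho] per
   layer. *)
have size i : C%:R * (layer_size h (h + C) i)%:R + h%:R <= rho ^+ i * (h%:R * (C%:R + 1)).
  elim: i => [|i IH]; first by rewrite /= expr0; lra.
  have := layer_size_growth_le h (h + C) i.
  set s := layer_size _ _ i in IH *; set s' := layer_size _ _ _ => le.
  have {}le : h%:R * s'%:R + 1 <= s%:R * (h%:R + C%:R) + h%:R :> R.
    rewrite -!natrD -!natrM -natrD -[X in _ + X]/(1%:R) -natrD ler_nat.
    by move: le; rewrite /s'; lia.
  rewrite exprS -mulrA -(ler_pM2l hR).
  have : h%:R * (rho * (C%:R * s%:R + h%:R)) <= h%:R * (rho * (rho ^+ i * (h%:R * (C%:R + 1)))).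
    by rewrite !ler_pM2l.
  apply: le_trans; rewrite mulrA (mulrC h%:R rho) rhoE.
  nra.
elim: m => [|m IH]; first by rewrite big_ord0 mulr0 expr0 subrr mulr0.
rewrite big_ord_recr /= natrD mulrDr (exprS rho).
have := size m; set s := (layer_size _ _ m)%:R.
have : 0 < rho ^+ m by rewrite exprn_gt0.
move: (rho ^+ m) IH => P IH P0 le.
have : 2 * h%:R ^+ 2 * (rho * P - 1) = 2 * h%:R * P * (rho * h%:R) - 2 * h%:R ^+ 2 by ring.
rewrite rhoE => ->.
have : P * h%:R <= P * h%:R * C%:R by rewrite ler_peMr // mulr_ge0 ?ltW.
nra.
Qed.

(** Two paths of [N./2] vertices fit into [N], and [N + 1] exceeds [n / Delta]; the threshold 64
    covers the rounding. *)
Lemma worst_recourse_linear Delta n : (3 <= Delta)%N ->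
  64%:R <= n%:R / Delta%:R :> R ->
  32%:R^-1 * (n%:R / Delta%:R) <= (worst_recourse (n %/ (Delta - 2).+1) 2 0)%:R :> R.
Proof.
move=> D3; set N := (n %/ _)%N; set T : R := _ / _ => T64.
have D0 : 0 < Delta%:R :> R by rewrite ltr0n; lia.
have TN : T < N%:R + 1.
  rewrite ltr_pdivrMr // natr1 -natrM ltr_nat.
  have := ltn_ceil n (ltn0Sn (Delta - 2)); rewrite -/N => H.
  by apply: leq_trans H _; rewrite leq_mul2l; lia.
have N63 : (63 < N)%N by rewrite -(ltr_nat R); lra.
have : (N <= (N./2).-1.*2 + 3)%N by have := odd_double_half N; lia.
rewrite -(ler_nat R) natrD -mul2n natrM => NN.
have : (N./2).-1%:R <= (worst_recourse N 2 0)%:R :> R.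
  by rewrite ler_nat; apply: path_worst_recourse; have := odd_double_half N; lia.
have : 64%:R <= N%:R :> R by rewrite ler_nat.
lra.
Qed.

(** From [y / x <= 4 * (y / a)] and [1 + 4 * z <= (1 + 2 * z) ^+ 2]. It bounds the growth factor
    [(h + C) / h] by the square of [(Delta + C) / (Delta - C)]. *)
Lemma ratio_le_sqr (a x y : R) : 0 < a -> 0 < x -> 0 < y -> a <= 4 * x ->
  1 + y / x <= (1 + 2 * y / a) ^+ 2.
Proof.
move=> a0 x0 y0 ax; rewrite -mulrA.
have z0 : 0 < y / a by rewrite divr_gt0.
have : y / x <= 4 * (y / a).
  have : y / a * a <= y / a * (4 * x) by rewrite ler_pM2l.
  by rewrite divfK ?lt0r_neq0 // ler_pdivrMr // [4 * _ * x]mulrAC [4 * x * _]mulrC.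
by move: (y / a) z0 => z; nra.
Qed.

Lemma exprM16 (x : R) m : x ^+ (m * 16) = x ^+ 2 ^+ m ^+ 8.
Proof. by rewrite -[in RHS]exprM -[in RHS]exprM mulnCA. Qed.

(** The exponent 16 combines the square of [ratio_le_sqr] with the eighth power of [bernoulli8].
    With [P = rho ^+ m] and [S] the sum, [16 * C * S <= 4 * h ^+ 2 * (8 * (P - 1)) <= a ^+ 2 * X = n
    * C]. The factor 8 in the conclusion leaves room for dividing [n] by [q.+1]. *)
Lemma layer_size_sum_le h C n m (a : R) : (0 < h)%N -> (0 < C)%N ->
  2 * h%:R <= a -> a <= 4 * h%:R ->
  (1 + 2 * C%:R / a) ^+ (m * 16) <= n%:R * C%:R / a ^+ 2 ->
  ((\sum_(i < m) layer_size h (h + C) i).*2 * 8 <= n)%N.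
Proof.
move=> h0 C0 a_ge a_le; set rho1 := 1 + _; set X := _ / _ => rhoX.
have hR : 0 < h%:R :> R by rewrite ltr0n.
have CR : 0 < C%:R :> R by rewrite ltr0n.
have a0 : 0 < a by lra.
have sumS := layer_size_sum h C m h0 C0.
set rho : R := (h + C)%:R / h%:R in sumS.
have rhoE : rho = 1 + C%:R / h%:R by rewrite /rho natrD mulrDl divff // lt0r_neq0.
have rho_le : rho <= rho1 ^+ 2 by rewrite rhoE; apply: ratio_le_sqr.
have rho_ge1 : 1 <= rho by rewrite rhoE lerDl divr_ge0 // ltW.
have rho1_ge1 : 1 <= rho1 by rewrite lerDl divr_ge0 ?mulr_ge0 // ltW.
have Xa : X * a ^+ 2 = n%:R * C%:R by rewrite /X divfK // expf_neq0 // lt0r_neq0.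
clearbody X rho rho1.
have P8 : (rho ^+ m) ^+ 8 <= X.
  apply: le_trans rhoX; rewrite exprM16.
  have rho_ge0 := le_trans ler01 rho_ge1.
  have rho1_ge0 := le_trans ler01 rho1_ge1.
  by rewrite lerXn2r ?nnegrE ?exprn_ge0 // lerXn2r ?nnegrE ?exprn_ge0.
have P1 : 1 <= rho ^+ m by rewrite exprn_ege1.
have := bernoulli8 _ P1.
move: (rho ^+ m) P1 P8 sumS => P P1 P8 sumS B8.
move: (P ^+ 8) P8 B8 => P' P8 B8.
rewrite -(ler_nat R) -mul2n !natrM -(ler_pM2r CR) -Xa.
have hA : h%:R ^+ 2 * 4 <= a ^+ 2.
  by rewrite -[4](_ : 2 ^+ 2 = _); [rewrite -exprMn mulrC lerXn2r ?nnegrE //; lra | ring].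
have H0 : 0 < h%:R ^+ 2 :> R by rewrite exprn_gt0.
have hX : h%:R ^+ 2 * (8 * (P - 1)) <= h%:R ^+ 2 * X by rewrite ler_pM2l //; lra.
have X0 : 0 <= X by lra.
move: (h%:R ^+ 2) (a ^+ 2) sumS hA H0 hX => H A sumS hA H0 hX.
move: (_ %:R) sumS => S sumS.
have : X * (H * 4) <= X * A by rewrite ler_wpM2l.
nra.
Qed.

Lemma worst_recourse_log Delta C n : (1 <= C)%N -> (C <= Delta - 3)%N -> (3 <= Delta)%N ->
  let bound : R := ln (n%:R * C%:R / (Delta%:R - C%:R) ^+ 2)
                   / ln ((Delta%:R + C%:R) / (Delta%:R - C%:R)) in
  64%:R <= bound ->
  exists2 q, (1 <= q < (Delta - C - 2).+1)%N &
    32%:R^-1 * bound <= (worst_recourse (n %/ q.+1) (Delta - q) C)%:R.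
Proof.
move=> C1 CD D3; set X := (X in ln X / _); set rho1 := (X in _ / ln X) => T T64.
(* This makes [Delta - C - q] even, and [Delta - C >= 3] then leaves [h > 0]. *)
pose q := (if odd (Delta - C) then 1 else 2)%N.
pose h := ((Delta - C - q)./2)%N.
have aE : (Delta - C = h.*2 + q)%N.
  have := odd_double_half (Delta - C - q); rewrite -/h oddB; last by rewrite /q; case: odd; lia.
  rewrite /q; case: (odd (Delta - C)) => /=; lia.
have q2 : (1 <= q <= 2)%N by rewrite /q; case: odd.
have h0 : (0 < h)%N by move: aE; rewrite /q; case: ifP => //; lia.
have q_h : (q <= h.*2)%N by lia.
have DqE : (Delta - q = h + (h + C))%N by lia.
have q8 : (q.+1 <= 8)%N by lia.
exists q; first lia.
have hR : 1 <= h%:R :> R by rewrite ler1n.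
have CR : 1 <= C%:R :> R by rewrite ler1n.
set a : R := Delta%:R - C%:R in X rho1 T T64 *.
have aR : a = (h.*2 + q)%:R by rewrite /a -aE natrB //; lia.
have a_ge : 2 * h%:R <= a by rewrite aR natrD -mul2n natrM lerDl.
have a_le : a <= 4 * h%:R.
  rewrite aR -[4]/(4%:R) -natrM ler_nat; lia.
have rho1E : rho1 = 1 + 2 * C%:R / a.
  have E (b c : R) : b != 0 -> (b + c + c) / b = 1 + 2 * c / b by move=> b0; field.
  by rewrite -E; [rewrite subrK | apply: lt0r_neq0; lra].
have y0 : 0 < C%:R / a by rewrite divr_gt0 //; lra.
have rho1_gt1 : 1 < rho1 by rewrite rho1E -mulrA; lra.
have lnrho : 0 < ln rho1 by rewrite ln_gt0.
have lnX : ln X = T * ln rho1 by rewrite divfK // lt0r_neq0.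
have X1 : 1 < X.
  rewrite ltNge; apply/negP => /ln_le0; rewrite lnX leNgt mulr_gt0 //; lra.
pose m := Num.truncn (T / 16%:R).
have /andP[m_le m_gt] : m%:R <= T / 16%:R < m.+1%:R by apply: truncn_itv; lra.
have m4 : (4 <= m)%N by rewrite -ltnS -(ltr_nat R); lra.
have rhoX : rho1 ^+ (m * 16) <= X.
  rewrite -ler_ln ?posrE ?exprn_gt0 //; [|lra|lra].
  rewrite lnXn; last lra.
  rewrite lnX -mulr_natl natrM ler_pM2r //; lra.
have S_le := layer_size_sum_le h C n m a h0 C1 a_ge a_le.
rewrite -rho1E in S_le; have {}S_le := S_le rhoX.
have m0 : (0 < m)%N := leq_trans (isT : 0 < 4)%N m4.
(* The [m] layers of a side have [m.-1] cuts, and [m - 1 > T / 16 - 2 >= T / 32] because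
   [T >= 64]. *)
have : (m.-1 <= worst_recourse (n %/ q.+1) (Delta - q) C)%N.
  rewrite DqE; apply: layer_size_worst_recourse => //.
    by rewrite -ltnS prednK // (leq_trans _ m4).
  rewrite prednK //.
  apply: (@leq_trans (n %/ 8)); first by rewrite leq_divRL.
  exact: leq_div2l.
rewrite -(ler_nat R); apply: le_trans.
rewrite -subn1 natrB //.
move: T64 m_gt; rewrite -natr1; clearbody T; clear; lra.
Qed.

End Asymptotics.

(** Maximum degree [Delta] takes [Delta.+1] vertices, whence [maxn n Delta.+1]. The asymptotic
    bounds hold with the constant [c] once the quantity reaches [M]. *)
Theorem mainTheorem5 (R : realType) :
  exists (K : nat) (c M : R), 0 < c /\
  forall (Delta C n : nat), (3 <= Delta)%N -> (C <= Delta - 3)%N ->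
  exists (G : {set {set 'I_(maxn n Delta.+1)}}) (e : {set 'I_(maxn n Delta.+1)})
         (col : {ffun {set 'I_(maxn n Delta.+1)} -> option 'I_(Delta + C)}),
    [/\ simple_graph G,
        max_degree G = Delta,
        colored_except G col e,
        (exists2 col' : {ffun {set 'I_(maxn n Delta.+1)} -> option 'I_(Delta + C)},
           full_coloring G col' & (recourse G col col' <= K)%N) &
        forall col' : {ffun {set 'I_(maxn n Delta.+1)} -> option 'I_(Delta + C)},
          shift_based G col e col' ->
          [/\ (\max_(1 <= q < (Delta - C - 2).+1)
                 worst_recourse (n %/ q.+1) (Delta - q) C
               <= recourse G col col')%N,
              C = 0%N ->
              M <= n%:R / Delta%:R ->
              c * (n%:R / Delta%:R) <= (recourse G col col')%:R &
              (4 <= Delta)%N -> (1 <= C)%N ->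
              let bound : R := ln (n%:R * C%:R / (Delta%:R - C%:R) ^+ 2)
                               / ln ((Delta%:R + C%:R) / (Delta%:R - C%:R)) in
              M <= bound ->
              c * bound <= (recourse G col col')%:R]].
Proof.
exists 2%N, 32%:R^-1, 64%:R; split; first by rewrite invr_gt0 ltr0n.
move=> Delta C n D3 CD.
have [G [e [col [sG dG cG fG sbG]]]] := recourse_instance Delta C n D3 CD.
exists G, e, col; split=> // col' /sbG recG; split=> //.
  move=> C0 /(worst_recourse_linear _ _ _ D3)/le_trans; apply.
  rewrite ler_nat; apply: leq_trans recG; subst C.
  apply: (bigmaxn_sup_seq (Delta - 2)%N) => //; first by rewrite mem_index_iota; lia.
  by rewrite subKn //; lia.
move=> _ C1 bound /(worst_recourse_log _ _ _ _ C1 CD D3)[q qr /le_trans]; apply.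
rewrite ler_nat; apply: leq_trans recG.
by apply: (bigmaxn_sup_seq q); rewrite ?mem_index_iota.
Qed.
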